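(* Let $\mathbb{K}$ be a field of characteristic $\neq 2$ and let $p,q\ge 0$. In $Cl(p+1,q+1)$ let $e,\tilde e$ be basis vectors with $e^2=1$, $\tilde e^2=-1$, let $Cl(p,q)\subset Cl(p+1,q+1)$ be the subalgebra generated by the remaining basis vectors, and put $P_\pm=\frac12(1\pm\tilde e e)$. Let $a\in Cl(p+1,q+1)$ be decomposed in two ways, $$a=P_+a_0^+ + P_+e\,a_1^+ + P_-a_0^- + P_-e\,a_1^- = \bar a_0^+P_+ + \bar a_1^+eP_+ + \bar a_0^-P_- + \bar a_1^-eP_-,$$ with $a_i^\pm,\bar a_i^\pm\in Cl(p,q)$. Then $$\begin{bmatrix}\bar a_0^+ & \bar a_1^-\\ \alpha(\bar a_1^+) & \alpha(\bar a_0^-)\end{bmatrix}=\begin{bmatrix}a_0^+ & \alpha(a_1^+)\\ a_1^- & \alpha(a_0^-)\end{bmatrix}.$$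
   Context: $Cl(p,q)$ is the Clifford algebra over $\mathbb{K}$ generated by $p+q$ pairwise anticommuting basis vectors, $p$ of which square to $1$ and $q$ of which square to $-1$. $\alpha$ is the parity automorphism: the algebra automorphism sending every basis vector $v$ to $-v$. *)

(* Defs.v *)
From HB Require Import structures.
From mathcomp Require Import all_boot all_order all_algebra all_field.

Set Implicit Arguments.
Unset Strict Implicit.
Unset Printing Implicit Defensive.

Import GRing.Theory.

Local Open Scope ring_scope.

Section SymDiff.
Variable T : finType.
Implicit Types A B C : {set T}.

Definition symdiff A B : {set T} := [set k | (k \in A) (+) (k \in B)].

Lemma symdiffA A B C : symdiff A (symdiff B C) = symdiff (symdiff A B) C.
Proof. by apply/setP => k; rewrite !inE addbA. Qed.

Lemma symdiffC A B : symdiff A B = symdiff B A.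
Proof. by apply/setP => k; rewrite !inE addbC. Qed.

Lemma symdiffK A B : symdiff A (symdiff A B) = B.
Proof. by apply/setP => k; rewrite !inE addKb. Qed.

Lemma symdiff0 A : symdiff A set0 = A.
Proof. by apply/setP => k; rewrite !inE addbF. Qed.

Lemma symdiff_inj A : injective (symdiff A).
Proof. exact: can_inj (symdiffK A). Qed.

Lemma symdiffv A : symdiff A A = set0.
Proof. by apply/setP => k; rewrite !inE addbb. Qed.

Lemma symdiff_eq0 A B : (symdiff A B == set0) = (B == A).
Proof. by rewrite -(inj_eq (@symdiff_inj A)) symdiffK symdiff0. Qed.

Lemma prod_symdiff (R : comNzRingType) (f : T -> R) A B :
    (forall k, f k * f k = 1) ->
  \prod_(k in symdiff A B) f k = \prod_(k in A) f k * \prod_(k in B) f k.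
Proof.
move=> f2; rewrite (big_mkcond (mem A)) (big_mkcond (mem B)) /=.
rewrite big_mkcond -big_split; apply: eq_bigr => k _ /=; rewrite inE.
by case: (k \in A); case: (k \in B); rewrite /= ?mulr1 ?mul1r ?f2.
Qed.

End SymDiff.

(* Cl(p,q) is realized on its basis of blades: the set A of indices stands for
   the product, in increasing order, of the basis vectors v_k with k in A (this
   is Cl_blade_prod below).  The product of the blades A and B is then the blade
   on their symmetric difference, up to a sign. *)
Definition Cl (K : fieldType) (p q : nat) :=
  {ffun {set 'I_(p + q)} -> K^o}.

HB.instance Definition _ K p q :=
  Vector.copy (Cl K p q) {ffun {set 'I_(p + q)} -> K^o}.

Section Clifford.
Variables (K : fieldType) (p q : nat).
Notation I := 'I_(p + q).
Notation C := (Cl K p q).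
Implicit Types (k l : I) (A B D : {set I}) (x y z : C).

Definition Cl_square k : K := if (k < p)%N then 1 else -1.

(* The factor contributed by v_k in the left blade and v_l in the right blade
   when their product is put back in increasing order. *)
Definition Cl_swap k l : K :=
  if (l < k)%N then -1 else if k == l then Cl_square k else 1.

Definition Cl_sign A B : K := \prod_(k in A) \prod_(l in B) Cl_swap k l.

Lemma Cl_swap2 k l : Cl_swap k l * Cl_swap k l = 1.
Proof.
by rewrite /Cl_swap /Cl_square; do ![case: ifP => _]; rewrite ?mulrNN mulr1.
Qed.

Lemma Cl_signDl A B D :
  Cl_sign (symdiff A B) D = Cl_sign A D * Cl_sign B D.
Proof.
rewrite /Cl_sign prod_symdiff // => k; rewrite -big_split /=.
by rewrite big1 // => l _; rewrite Cl_swap2.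
Qed.

Lemma Cl_signDr A B D :
  Cl_sign D (symdiff A B) = Cl_sign D A * Cl_sign D B.
Proof.
rewrite /Cl_sign -big_split; apply: eq_bigr => k _ /=.
by rewrite prod_symdiff // => l; rewrite Cl_swap2.
Qed.

Lemma Cl_sign0l A : Cl_sign set0 A = 1.
Proof. by rewrite /Cl_sign big_set0. Qed.

Lemma Cl_sign0r A : Cl_sign A set0 = 1.
Proof. by rewrite /Cl_sign big1 // => k _; rewrite big_set0. Qed.

Definition Cl_blade A : C := [ffun B => (B == A)%:R].

Definition Cl_mul x y : C :=
  [ffun D => \sum_A x A * y (symdiff A D) * Cl_sign A (symdiff A D)].

Lemma Cl_mulA : associative Cl_mul.
Proof.
move=> x y z; apply/ffunP => D; rewrite !ffunE.
under eq_bigr => A _ do rewrite ffunE mulr_sumr mulr_suml.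
under [RHS]eq_bigr => A _ do rewrite ffunE !mulr_suml.
rewrite [RHS]exchange_big; apply: eq_bigr => A _ /=.
rewrite [RHS](reindex_inj (@symdiff_inj _ A)); apply: eq_bigr => B _ /=.
rewrite symdiffK -symdiffA (symdiffC A (symdiff B D)).
rewrite (symdiffC A D) symdiffA; set E := symdiff (symdiff B D) A.
have ->: symdiff D A = symdiff B E by rewrite /E -symdiffA symdiffK.
rewrite Cl_signDl Cl_signDr -!mulrA; congr (_ * (_ * _)) => /=.
rewrite [RHS]mulrCA; congr (_ * _).
by rewrite mulrCA; congr (_ * _); rewrite mulrC.
Qed.

Lemma Cl_mul1l : left_id (Cl_blade set0) Cl_mul.
Proof.
move=> x; apply/ffunP => D; rewrite !ffunE (bigD1 set0) //= big1 => [|A /negPf].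
  by rewrite ffunE eqxx symdiffC symdiff0 Cl_sign0l mul1r mulr1 addr0.
by rewrite ffunE => ->; rewrite !mul0r.
Qed.

Lemma Cl_mul1r : right_id (Cl_blade set0) Cl_mul.
Proof.
move=> x; apply/ffunP => D; rewrite !ffunE (bigD1 D) //= big1 => [|A /negPf AD].
  by rewrite ffunE symdiffv eqxx Cl_sign0r !mulr1 addr0.
by rewrite ffunE symdiff_eq0 eq_sym AD mulr0 mul0r.
Qed.

Lemma Cl_mulDl : left_distributive Cl_mul +%R.
Proof.
move=> x y z; apply/ffunP => D; rewrite !ffunE -big_split.
by apply: eq_bigr => A _; rewrite ffunE !mulrDl.
Qed.

Lemma Cl_mulDr : right_distributive Cl_mul +%R.
Proof.
move=> x y z; apply/ffunP => D; rewrite !ffunE -big_split.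
by apply: eq_bigr => A _; rewrite ffunE mulrDr mulrDl.
Qed.

Lemma Cl_blade_neq0 A : Cl_blade A != 0.
Proof.
apply/eqP => /ffunP/(_ A); rewrite !ffunE eqxx => /eqP.
by rewrite oner_eq0.
Qed.

HB.instance Definition _ := GRing.Zmodule_isNzRing.Build C
  Cl_mulA Cl_mul1l Cl_mul1r Cl_mulDl Cl_mulDr (Cl_blade_neq0 set0).

Lemma Cl_scalerAl (a : K) x y : a *: (x * y) = a *: x * y.
Proof.
apply/ffunP => D; rewrite !ffunE [LHS]mulr_sumr.
by apply: eq_bigr => A _; rewrite ffunE -!mulrA.
Qed.

HB.instance Definition _ := GRing.Lmodule_isLalgebra.Build K C Cl_scalerAl.

Lemma Cl_scalerAr (a : K) x y : a *: (x * y) = x * (a *: y).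
Proof.
apply/ffunP => D; rewrite !ffunE [LHS]mulr_sumr.
by apply: eq_bigr => A _; rewrite ffunE [a *: y _]/(a * y _) -!mulrA mulrCA.
Qed.

HB.instance Definition _ := GRing.Lalgebra_isAlgebra.Build K C Cl_scalerAr.
HB.instance Definition _ := Algebra_isFalgebra.Build K C.

Definition Cl_vec k : C := Cl_blade [set k].

Lemma Cl_bladeM A B :
  Cl_blade A * Cl_blade B = Cl_sign A B *: Cl_blade (symdiff A B).
Proof.
apply/ffunP => D; rewrite !ffunE (bigD1 A) //= big1 => [|E /negPf AE].
  rewrite !ffunE eqxx mul1r addr0.
  have [->|DAB] := eqVneq D (symdiff A B).
    by rewrite symdiffK eqxx mul1r [RHS]mulr1.
  rewrite [RHS]mulr0; have [DB|_] := eqVneq (symdiff A D) B; last exact: mul0r.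
  by rewrite -DB symdiffK eqxx in DAB.
by rewrite ffunE AE !mul0r.
Qed.

Lemma Cl_sign_vec k l : Cl_sign [set k] [set l] = Cl_swap k l.
Proof. by rewrite /Cl_sign !big_set1. Qed.

Lemma Cl_vec_square k : Cl_vec k ^+ 2 = if (k < p)%N then 1 else -1.
Proof.
rewrite expr2 Cl_bladeM symdiffv Cl_sign_vec /Cl_swap ltnn eqxx /Cl_square.
by case: ifP; rewrite ?scale1r ?scaleN1r.
Qed.

Lemma Cl_vec_anticomm k l : k != l -> Cl_vec k * Cl_vec l = - (Cl_vec l * Cl_vec k).
Proof.
move=> kl; rewrite !Cl_bladeM symdiffC !Cl_sign_vec /Cl_swap (eq_sym l) (negPf kl).
by case: (ltngtP k l) => [||/val_inj/eqP]; rewrite ?(negPf kl) // !scaleN1r ?opprK scale1r.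
Qed.

Lemma Cl_blade_sorted (s : seq I) : sorted ltn (map val s) ->
  \prod_(k <- s) Cl_vec k = Cl_blade [set k in s].
Proof.
elim: s => [|k s IHs] /=.
  by rewrite big_nil => _; congr Cl_blade; apply/setP => l; rewrite !inE.
rewrite (path_sortedE ltn_trans) all_map => /andP[/allP ks /IHs sK].
rewrite big_cons sK Cl_bladeM.
have kNs : k \notin s by apply/negP => /ks /=; rewrite ltnn.
rewrite /Cl_sign big_set1 big1 => [|l]; last first.
  rewrite inE => /ks /= kl; rewrite /Cl_swap ltnNge (ltnW kl) /=.
  by case: eqP kl => // ->; rewrite ltnn.
rewrite scale1r; congr Cl_blade; apply/setP => l; rewrite !inE.
by case: eqP => // ->; rewrite (negPf kNs).
Qed.

Lemma Cl_blade_prod A : Cl_blade A = \prod_(k in A) Cl_vec k.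
Proof.
rewrite -big_filter Cl_blade_sorted.
  by congr Cl_blade; apply/setP => k; rewrite !inE mem_filter mem_index_enum andbT.
rewrite sorted_map; apply: sorted_filter => [? ? ?|]; first exact: ltn_trans.
by rewrite -sorted_map [index_enum _]unlock -enumT val_enum_ord iota_ltn_sorted.
Qed.

(* The index type 'I_(p + q) is enumerated increasingly, so these are the
   ordered products; together with dim_Cl, they form a basis. *)
Lemma Cl_expand x : x = \sum_A x A *: \prod_(k in A) Cl_vec k.
Proof.
apply/ffunP => D.
rewrite -[in RHS](eq_bigr _ (fun A _ => congr1 ( *:%R (x A)) (Cl_blade_prod A))).
rewrite sum_ffunE (bigD1 D) //= big1 => [|A /negPf DA].
  by rewrite !ffunE eqxx addr0 [RHS]mulr1.
by rewrite !ffunE eq_sym DA [LHS]mulr0.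
Qed.

Lemma dim_Cl : \dim {:C} = (2 ^ (p + q))%N.
Proof. by rewrite dimvf /dim /= muln1 -cardsT -powersetT card_powerset cardsT card_ord. Qed.

Definition is_parity (alpha : {lrmorphism C -> C}) : Prop :=
  bijective alpha /\ forall k, alpha (Cl_vec k) = - Cl_vec k.

Definition Cl_parity x : C := [ffun A : {set I} => (-1) ^+ #|A| * x A].

Lemma Cl_parity_linear : linear Cl_parity.
Proof.
move=> a x y; apply/ffunP => A; rewrite !ffunE mulrDr; congr (_ + _).
by rewrite [a *: x A]/(a * _) mulrCA.
Qed.
HB.instance Definition _ := GRing.isLinear.Build K C C *:%R Cl_parity
  Cl_parity_linear.

Lemma Cl_parity_monoid : monoid_morphism Cl_parity.
Proof.
have sgE A : (-1) ^+ #|A| = \prod_(k in A) (-1 : K) by rewrite prodr_const.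
split=> [|x y].
  apply/ffunP => A; rewrite !ffunE; case: eqP => [->|_]; last by rewrite mulr0.
  by rewrite cards0 mul1r.
apply/ffunP => D; rewrite !ffunE mulr_sumr; apply: eq_bigr => A _.
have -> : (-1) ^+ #|D| = (-1) ^+ #|A| * (-1) ^+ #|symdiff A D| :> K.
  by rewrite -[in LHS](symdiffK A D) !sgE prod_symdiff // => k; rewrite mulrNN mulr1.
by rewrite !ffunE -!mulrA; congr (_ * _); rewrite mulrCA.
Qed.
HB.instance Definition _ := GRing.isMonoidMorphism.Build C C Cl_parity
  Cl_parity_monoid.

Lemma Cl_parityP : is_parity Cl_parity.
Proof.
split=> [|k].
  have parityK : involutive Cl_parity.
    move=> x; apply/ffunP => A.
    by rewrite !ffunE mulrA -expr2 -exprM muln2 -signr_odd odd_double mul1r.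
  by exists Cl_parity.
apply/ffunP => A; rewrite !ffunE.
by case: eqP => [->|_]; rewrite ?cards1 ?mulr1 // mulr0 oppr0.
Qed.

Lemma is_parity_uniq (alpha beta : {lrmorphism C -> C}) :
  is_parity alpha -> is_parity beta -> alpha =1 beta.
Proof.
move=> [_ av] [_ bv] x; rewrite (Cl_expand x) !linear_sum; apply: eq_bigr => A _.
rewrite !linearZ !rmorph_prod; congr (_ *: _).
by apply: eq_bigr => k _ /=; rewrite av bv.
Qed.

Definition Cl_sub k l : {aspace C} :=
  <<1 & [seq Cl_vec m | m <- enum I & (m != k) && (m != l)]>>%AS.

End Clifford.

Definition mx22 (T : Type) (a b c d : T) : 'M[T]_2 :=
  \matrix_(i, j) if i == ord0 then (if j == ord0 then a else b)
                 else (if j == ord0 then c else d).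

(* Main.v *)
Require Import Defs.
From mathcomp Require Import all_boot all_order all_algebra all_field.

Set Implicit Arguments.
Unset Strict Implicit.
Unset Printing Implicit Defensive.

Import GRing.Theory.
Local Open Scope ring_scope.

(* The projections P+ and P- are orthogonal idempotents with sum 1 that are
   exchanged by conjugation with e and commute with Cl(p,q), while e x =
   alpha(x) e for x in Cl(p,q).  Moving the projections to the right turns the
   first decomposition into one of the second kind, and the coefficients of the
   latter are unique: its Peirce components are c P+- and c e P+-, and x P+ = 0
   implies x P- = 0 by applying alpha and conjugating with e. *)

Section TwistedCommutation.
Variables (K : fieldType) (A : algType K) (f : {lrmorphism A -> A}).

(** The only trace that membership in Cl(p,q) leaves in this section: there [v] is [e] or [te], and
    [f] is the parity automorphism. *)
Definition twisted_comm (v x : A) := v * x = f x * v.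

Lemma twisted_commB v x y :
  twisted_comm v x -> twisted_comm v y -> twisted_comm v (x - y).
Proof. by rewrite /twisted_comm => vx vy; rewrite mulrBr rmorphB mulrBl vx vy. Qed.

Hypothesis fK : involutive f.

(** Applying [f] to the relation produces a sign from [f v = - v] on each side, and the two
    cancel. *)
Lemma twisted_comm_morph v x :
  f v = - v -> twisted_comm v x -> twisted_comm v (f x).
Proof.
move=> fv /(congr1 f); rewrite /twisted_comm !rmorphM /= fv.
by rewrite mulNr mulrN => /oppr_inj.
Qed.

Variables e te : A.
Hypotheses (two_neq0 : 2 != 0 :> K) (e2 : e ^+ 2 = 1) (te2 : te ^+ 2 = -1)
  (tee : te * e = - (e * te)) (fe : f e = - e) (fte : f te = - te).

Let Pp := 2^-1 *: (1 + te * e).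
Let Pm := 2^-1 *: (1 - te * e).

(** So [te * e] is an involution, and [Pp], [Pm] are its spectral projections for the eigenvalues 1
    and -1. *)
Let tee2 : te * e * (te * e) = 1.
Proof.
by rewrite {2}tee mulrN mulrA -(mulrA te) -expr2 e2 mulr1 -expr2 te2 opprK.
Qed.

Let PpDPm : Pp + Pm = 1.
Proof.
rewrite -scalerDr addrACA subrr addr0 -mulr2n -scaler_nat scalerA.
by rewrite mulVf ?scale1r.
Qed.

Let PpPm : Pp * Pm = 0.
Proof.
rewrite -scalerAl -scalerAr mulrBr mulr1 mulrDl mul1r tee2.
by rewrite (addrC (te * e)) subrr !scaler0.
Qed.

Let PmPp : Pm * Pp = 0.
Proof.
rewrite -scalerAl -scalerAr mulrDr mulr1 mulrBl mul1r tee2.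
by rewrite addrA subrK subrr !scaler0.
Qed.

Let PpPp : Pp * Pp = Pp.
Proof. by rewrite -[RHS]mulr1 -PpDPm mulrDr PpPm addr0. Qed.

Let PmPm : Pm * Pm = Pm.
Proof. by rewrite -[RHS]mulr1 -PpDPm mulrDr PmPp add0r. Qed.

Let ePp : e * Pp = Pm * e.
Proof.
rewrite -scalerAr -scalerAl mulrDr mulrBl mulr1 mul1r mulrA.
by rewrite [X in - (X * e)]tee mulNr opprK.
Qed.

Let ePm : e * Pm = Pp * e.
Proof.
have: e * (Pp + Pm) = (Pp + Pm) * e by rewrite PpDPm mulr1 mul1r.
by rewrite mulrDr mulrDl ePp addrC => /addIr.
Qed.

Let ee x : e * (e * x) = x.
Proof. by rewrite mulrA -expr2 e2 mul1r. Qed.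

(** Passing [x] across [e] and then [te] applies [f] twice, which is the identity. *)
Let teeC x : twisted_comm e x -> twisted_comm te x -> te * e * x = x * (te * e).
Proof.
move=> ex tex; have := twisted_comm_morph fte tex.
by rewrite /twisted_comm fK -mulrA ex !mulrA => ->.
Qed.

Let PpC x : twisted_comm e x -> twisted_comm te x -> Pp * x = x * Pp.
Proof.
by move=> ex tex; rewrite -scalerAl -scalerAr mulrDl mulrDr mul1r mulr1 teeC.
Qed.

Let PmC x : twisted_comm e x -> twisted_comm te x -> Pm * x = x * Pm.
Proof.
by move=> ex tex; rewrite -scalerAl -scalerAr mulrBl mulrBr mul1r mulr1 teeC.
Qed.

Let fPp : f Pp = Pp.
Proof. by rewrite linearZ /= rmorphD rmorph1 rmorphM /= fe fte mulrNN. Qed.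

Let twisted_proj_eq0 x : twisted_comm e x -> x * Pp = 0 -> x = 0.
Proof.
move=> /(twisted_comm_morph fe); rewrite /twisted_comm fK => ex xPp.
(* As [e * f x = x * e] and [f] fixes [Pp], this product equals [x * Pm]. *)
have: e * f (x * Pp) * e = 0 by rewrite xPp rmorph0 mulr0 mul0r.
rewrite rmorphM /= fPp mulrA ex -!mulrA (mulrA e) ePp -mulrA -expr2 e2 mulr1.
move=> xPm.
by rewrite -[x]mulr1 -PpDPm mulrDr xPp xPm addr0.
Qed.

(** Right multiplication by a projection separates the [Pp] terms from the [Pm] terms. Left
    multiplication by the same one then keeps the term without [e] and kills the one with [e], since
    [e] exchanges the projections. *)
Lemma twisted_peirce_eq0 x0p x1p x0m x1m :
    twisted_comm e x0p -> twisted_comm te x0p ->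
    twisted_comm e x1p -> twisted_comm te x1p ->
    twisted_comm e x0m -> twisted_comm te x0m ->
    twisted_comm e x1m -> twisted_comm te x1m ->
    x0p * Pp + x1p * e * Pp + x0m * Pm + x1m * e * Pm = 0 ->
  [/\ x0p = 0, x1p = 0, x0m = 0 & x1m = 0].
Proof.
move=> e0p te0p e1p te1p e0m te0m e1m te1m x0.
(* Reduces to the case of [Pp] through [f y * Pp = e * (y * Pm) * e]. *)
have xPm0 y : twisted_comm e y -> y * Pm = 0 -> y = 0.
  move=> ey yPm; have eyf := twisted_comm_morph fe ey.
  rewrite -[y]fK (twisted_proj_eq0 eyf) ?rmorph0 //.
  rewrite -[f y * Pp]mulr1 -e2 expr2 mulrA -(mulrA _ Pp) -ePm mulrA -ey.
  by rewrite -(mulrA e) yPm mulr0 mul0r.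
have xPp : x0p * Pp + x1p * e * Pp = 0.
  have /(congr1 ( *%R^~ Pp)) := x0.
  by rewrite /= !mulrDl mul0r -!mulrA PpPp PmPp !mulr0 !addr0.
have xPm : x0m * Pm + x1m * e * Pm = 0.
  have /(congr1 ( *%R^~ Pm)) := x0.
  by rewrite /= !mulrDl mul0r -!mulrA PmPm PpPm !mulr0 !add0r.
have x0p0 : x0p = 0.
  have /(congr1 ( *%R Pp)) := xPp.
  rewrite mulrDr mulr0 !mulrA !PpC // -!mulrA ePp PpPp (mulrA Pp) PpPm mul0r.
  by rewrite mulr0 addr0 => /(twisted_proj_eq0 e0p).
have x0m0 : x0m = 0.
  have /(congr1 ( *%R Pm)) := xPm.
  rewrite mulrDr mulr0 !mulrA !PmC // -!mulrA ePm PmPm (mulrA Pm) PmPp mul0r.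
  by rewrite mulr0 addr0 => /(xPm0 _ e0m).
split=> //.
  apply: (xPm0 _ e1p); move: xPp; rewrite x0p0 mul0r add0r -mulrA ePp.
  by move/(congr1 ( *%R^~ e)); rewrite /= -!mulrA -expr2 e2 mulr1 mul0r.
apply: (twisted_proj_eq0 e1m); move: xPm; rewrite x0m0 mul0r add0r -mulrA ePm.
by move/(congr1 ( *%R^~ e)); rewrite /= -!mulrA -expr2 e2 mulr1 mul0r.
Qed.

(** The index 1 coefficients swap signs because [Pm * e * a1m = f a1m * e * Pp], and likewise with
    [Pp] and [Pm] exchanged. *)
Lemma left_right_peirce_coef a a0p a1p a0m a1m b0p b1p b0m b1m :
    {in [:: a0p; a1p; a0m; a1m; b0p; b1p; b0m; b1m],
      forall x, twisted_comm e x /\ twisted_comm te x} ->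
    a = Pp * a0p + Pp * e * a1p + Pm * a0m + Pm * e * a1m ->
    a = b0p * Pp + b1p * e * Pp + b0m * Pm + b1m * e * Pm ->
  [/\ b0p = a0p, b1p = f a1m, b0m = a0m & b1m = f a1p].
Proof.
move=> tw aE aE'.
have subC x y : x \in [:: a0p; a1p; a0m; a1m; b0p; b1p; b0m; b1m] ->
    y \in [:: a0p; a1p; a0m; a1m; b0p; b1p; b0m; b1m] ->
    [/\ twisted_comm e (x - y), twisted_comm te (x - y),
        twisted_comm e (x - f y) & twisted_comm te (x - f y)].
  by move=> /tw[ex tex] /tw[ey tey]; split; apply: twisted_commB => //;
    apply: twisted_comm_morph.
have [||e0p te0p _ _] := subC b0p a0p; rewrite ?(inE, eqxx, orbT) //.
have [||e0m te0m _ _] := subC b0m a0m; rewrite ?(inE, eqxx, orbT) //.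
have [||_ _ e1p te1p] := subC b1p a1m; rewrite ?(inE, eqxx, orbT) //.
have [||_ _ e1m te1m] := subC b1m a1p; rewrite ?(inE, eqxx, orbT) //.
have [|/subr0_eq-> /subr0_eq-> /subr0_eq-> /subr0_eq->] := twisted_peirce_eq0
  e0p te0p e1p te1p e0m te0m e1m te1m; last by split.
have [a0pe a0pt] := tw a0p ltac:(by rewrite ?(inE, eqxx, orbT)).
have [a1pe a1pt] := tw a1p ltac:(by rewrite ?(inE, eqxx, orbT)).
have [a0me a0mt] := tw a0m ltac:(by rewrite ?(inE, eqxx, orbT)).
have [a1me a1mt] := tw a1m ltac:(by rewrite ?(inE, eqxx, orbT)).
have {aE} aE : a = a0p * Pp + f a1m * e * Pp + a0m * Pm + f a1p * e * Pm.
  rewrite aE PpC // PmC // -(mulrA Pp) -(mulrA Pm) a1pe a1me.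
  rewrite (mulrA Pp) (mulrA Pm) PpC ?PmC; try exact: twisted_comm_morph.
  rewrite -!mulrA ePp ePm -!addrA; congr (_ + _).
  by rewrite [LHS]addrC -addrA addrCA.
(* The combination of coefficient differences regroups as [a - a]. *)
by rewrite !mulrBl; do 3!rewrite (addrACA _ (- _)) -opprD; rewrite -aE -aE' subrr.
Qed.

End TwistedCommutation.

(* The set of all x satisfying the conclusion is a subalgebra. *)
Lemma agenv_twisted_comm (K : fieldType) (A : falgType K)
    (f : {lrmorphism A -> A}) (v : A) (vs : seq A) :
  (forall x, x \in vs -> v * x = f x * v) ->
  forall x, x \in <<1 & vs>>%VS -> v * x = f x * v.
Proof.
(* The solutions form the kernel of a linear map, hence a subspace; it remains to see that it
   contains 1 and is stable under left multiplication by the span of 1 and the generators. *)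
move=> fv; pose g : 'End(A) := linfun (v \o* f).
have gP x : reflect (v * x = f x * v) (x \in lker (amull v - g)).
  by apply: (iffP eqlfunP); rewrite /amull /g !lfunE.
have g1 : (1 <= lker (amull v - g))%VS.
  by rewrite -memvE; apply/gP; rewrite rmorph1 mulr1 mul1r.
have vs_g : (1 + <<vs>> <= lker (amull v - g))%VS.
  by rewrite subv_add g1; apply/span_subvP => x /fv /gP.
suff /subvP sub : (<<1 & vs>> <= lker (amull v - g))%VS by move=> x /sub /gP.
apply: agenv_sub_modl => //; apply/prodvP => x y.
move=> /(subvP vs_g)/gP vx /gP vy; apply/gP.
by rewrite rmorphM mulrA vx -mulrA vy mulrA.
Qed.

(** On an ordered product of basis vectors each factor changes sign twice. *)
Lemma is_parityK (K : fieldType) (p q : nat)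
    (alpha : {lrmorphism Cl K p q -> Cl K p q}) :
  is_parity alpha -> involutive alpha.
Proof.
case=> _ av x; rewrite [in RHS](Cl_expand x) [in LHS](Cl_expand x) !linear_sum.
apply: eq_bigr => A _; rewrite !linearZ !rmorph_prod; congr (_ *: _).
by apply: eq_bigr => k _ /=; rewrite av rmorphN /= av opprK.
Qed.

(** Each generator of the subalgebra anticommutes with both removed vectors and is negated by
    [alpha], so the relation holds on generators. *)
Lemma Cl_sub_twisted_comm (K : fieldType) (p q : nat)
    (alpha : {lrmorphism Cl K p q -> Cl K p q}) (k l : 'I_(p + q)) (x : Cl K p q) :
  is_parity alpha -> x \in Cl_sub K k l ->
  twisted_comm alpha (Cl_vec K k) x /\ twisted_comm alpha (Cl_vec K l) x.
Proof.
move=> [_ av] xS; split; move: x xS; apply: agenv_twisted_comm => _ /mapP[m + ->];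
  rewrite mem_filter => /andP[/andP[mk ml] _]; rewrite av mulNr Cl_vec_anticomm //;
  by rewrite eq_sym.
Qed.

Theorem mainTheorem3 (K : fieldType) (charK : 2%N \notin [pchar K]) (p q : nat)
    (alpha : {lrmorphism Cl K p.+1 q.+1 -> Cl K p.+1 q.+1})
    (alphaP : is_parity alpha)
    (k l : 'I_(p.+1 + q.+1)) :
  let e := Cl_vec K k in
  let te := Cl_vec K l in
  let Pp := 2^-1 *: (1 + te * e) in
  let Pm := 2^-1 *: (1 - te * e) in
  e ^+ 2 = 1 -> te ^+ 2 = -1 ->
  forall a a0p a1p a0m a1m b0p b1p b0m b1m : Cl K p.+1 q.+1,
  a0p \in Cl_sub K k l -> a1p \in Cl_sub K k l ->
  a0m \in Cl_sub K k l -> a1m \in Cl_sub K k l ->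
  b0p \in Cl_sub K k l -> b1p \in Cl_sub K k l ->
  b0m \in Cl_sub K k l -> b1m \in Cl_sub K k l ->
  a = Pp * a0p + Pp * e * a1p + Pm * a0m + Pm * e * a1m ->
  a = b0p * Pp + b1p * e * Pp + b0m * Pm + b1m * e * Pm ->
  mx22 b0p b1m (alpha b1p) (alpha b0m) =
  mx22 a0p (alpha a1p) a1m (alpha a0m).
Proof.
move=> e te Pp Pm e2 te2 a a0p a1p a0m a1m b0p b1p b0m b1m.
move=> a0pS a1pS a0mS a1mS b0pS b1pS b0mS b1mS aE aE'.
have two_neq0 : 2 != 0 :> K by move: charK; rewrite inE.
(* Equal indices would give 1 = -1, against the characteristic. *)
have kl : k != l.
  apply/eqP => kl; move: te2; rewrite /te -kl e2 => /eqP.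
  rewrite -addr_eq0 -mulr2n -scaler_nat scaler_eq0 oner_eq0 orbF.
  by rewrite (negPf two_neq0).
have tee : te * e = - (e * te) by apply: Cl_vec_anticomm; rewrite eq_sym.
have alphaK := is_parityK alphaP; have [_ av] := alphaP.
have [|-> -> -> ->] := left_right_peirce_coef alphaK two_neq0 e2 te2 tee
  (av k) (av l) _ aE aE'; last by rewrite !alphaK.
move=> x xs; apply: Cl_sub_twisted_comm => //; move: x xs; apply/allP.
by rewrite /= a0pS a1pS a0mS a1mS b0pS b1pS b0mS b1mS.
Qed.
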